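(* Suppose that the margin condition holds with constants $\kappa=1$ and $C>0$, that is, $$P(\gamma_j-\gamma_0)\ge d^2(f_j,f_0)/C^2,\qquad j=1,\dots,p,$$ and that the exponential moment condition holds for some $K>0$, that is, $P|\gamma_j^c-\gamma_*^c|^m\le\frac{m!}{2}(2K)^{m-2}d^2(f_j,f_* )$ for all $m=2,3,\dots$ and all $j=1,\dots,p$. Then for all $t>0$, when $\mathcal E_*>0$, $$\mathbf P\left(\sqrt{\hat{\mathcal E}}\ge\sqrt{\mathcal E_*}+C\sqrt{\Delta+2t/n}+\frac{K(\Delta+2t/n)}{\sqrt{\mathcal E_*}}\right)\le e^{-t},$$ and when $\mathcal E_*\le K(\Delta+2t/n)$, $$\mathbf P\left(\sqrt{\hat{\mathcal E}}\ge(C+2\sqrt K)\sqrt{\Delta+2t/n}\right)\le e^{-t}.$$ Moreover, for all $1\le m\le1+\log p$, when $\mathcal E_*>0$, $$\left\|\sqrt{\frac{\hat{\mathcal E}}{\mathcal E_*}}\right\|_m\le1+C\sqrt{\frac{\Delta}{\mathcal E_*}}+\frac{K\Delta}{\mathcal E_*},$$ and when $\mathcal E_*\le K\Delta$, $$\left\|\sqrt{\hat{\mathcal E}}\right\|_m\le(C+2\sqrt K)\sqrt\Delta.$$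
   Context: $Z_1,\dots,Z_n$ are independent (not necessarily identically distributed) random variables in a space $\mathcal Z$; $\mathbf P$ and $\mathbf E$ denote their distribution and expectation. For $\gamma:\mathcal Z\to\mathbb R$ put $P\gamma:=\frac1n\sum_{i=1}^n\mathbf E\gamma(Z_i)$ and $P_n\gamma:=\frac1n\sum_{i=1}^n\gamma(Z_i)$. $\gamma^c:=\gamma-\mathbf E\gamma$ denotes the centered function, i.e. $\gamma^c(Z_i)=\gamma(Z_i)-\mathbf E\gamma(Z_i)$ for each $i$, and $P|\gamma^c|^m=\frac1n\sum_i\mathbf E|\gamma^c(Z_i)|^m$. $\mathbf F$ is a subset of a metric space with metric $d$, and $\boldsymbol\Gamma=\{\gamma_f:f\in\mathbf F\}$ is a class of loss functions $\gamma_f:\mathcal Z\to\mathbb R$. Fixed (non-random) $f_1,\dots,f_p\in\mathbf F$ are given and $\gamma_j:=\gamma_{f_j}$. The empirical risk minimizer is $\hat\gamma:=\arg\min_{1\le j\le p}P_n\gamma_j$; the target is $\gamma_0=\gamma_{f_0}:=\arg\min_{\gamma\in\boldsymbol\Gamma}P\gamma$; the best approximation is $\gamma_*=\gamma_{f_*}:=\arg\min_{1\le j\le p}P\gamma_j$, with $f_*\in\{f_1,\dots,f_p\}$. Excess risks: $\hat{\mathcal E}:=P(\hat\gamma-\gamma_0)$ (a random variable: $P(\gamma_j-\gamma_0)$ evaluated at the selected index $j$) and $\mathcal E_*:=P(\gamma_*-\gamma_0)$. Also $\Delta:=2\log(2p)/n$ and $\|X\|_m:=(\mathbf E|X|^m)^{1/m}$.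 *)

(* Defs.v *)
From HB Require Import structures.
From mathcomp Require Import all_boot all_order all_algebra.
From mathcomp Require Import all_classical all_reals all_analysis.

Set Implicit Arguments.
Unset Strict Implicit.
Unset Printing Implicit Defensive.

Import Order.TTheory GRing.Theory Num.Theory.
Import numFieldNormedType.Exports.

Local Open Scope classical_set_scope.
Local Open Scope ring_scope.

(* [x] is one of the possibly several minimizers of [phi] on [A]. *)
Definition is_argmin (R : realType) (I : Type) (A : set I) (phi : I -> R)
    (x : I) : Prop :=
  A x /\ forall y, A y -> phi x <= phi y.

Section independence.
Context (d d' : measure_display) (Omega : measurableType d)
  (S : measurableType d') (R : realType) (P : probability Omega R) (n : nat).

Definition mutually_independent (Z : 'I_n -> {RV P >-> S}) : Prop :=
  forall (J : {set 'I_n}) (A : 'I_n -> set S),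
    (forall i, measurable (A i)) ->
    P (\bigcap_(i in [set` J]) (Z i @^-1` A i)) =
    (\prod_(i in J) P (Z i @^-1` A i))%E.

End independence.

Section averages.
Context (d d' : measure_display) (Omega : measurableType d)
  (S : measurableType d') (R : realType) (P : probability Omega R) (n : nat)
  (Z : 'I_n -> {RV P >-> S}).

(* [fine] is harmless for the [g] such that every [g (Z i)] is integrable. *)
Definition mean (i : 'I_n) (g : S -> R) : R := fine 'E_P[g \o Z i].

Definition avg_mean (g : S -> R) : R := n%:R^-1 * \sum_(i < n) mean i g.

Definition empirical_mean (w : Omega) (g : S -> R) : R :=
  n%:R^-1 * \sum_(i < n) g (Z i w).

(* As the [Z i] need not be identically distributed, the centering of [g]
   depends on [i]. *)
Definition centered (g : S -> R) (i : 'I_n) (w : Omega) : R :=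
  g (Z i w) - mean i g.

(* P |g^c - h^c|^m, possibly +oo *)
Definition avg_centered_moment (m : nat) (g h : S -> R) : \bar R :=
  ((n%:R^-1)%:E *
   \sum_(i < n) \int[P]_w (`|centered g i w - centered h i w| ^+ m)%:E)%E.

End averages.

(* Main.v *)
(* Write E_j for the excess risk of gamma_j, jhat for the selected index, and
   X_j for (P_n - P)(gamma_* - gamma_j).  Minimality of the empirical risk gives
   E_jhat - Estar <= X_jhat.  Dividing by sqrt E_j + A, for any
   A >= sqrt Estar, yields
     sqrt E_jhat <= A + max (0, W_jhat),  W_j := X_j / (sqrt E_j + A),
   and by the margin condition the W_j satisfy Bernstein's moment condition with
   the constants C^2 and 2K/A, uniformly in j, hence the corresponding bound on
   their moment generating functions.  The tail bound is then Markov's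
   inequality for sum_j exp (L W_j).  The moment bound is Jensen's inequality for
   z -> ln^m z, which is concave on z >= e^(m-1); this is where m <= 1 + ln p
   enters.  The two cases of the theorem are A = sqrt Estar and
   A = sqrt (K (Delta + 2t/n)), with t = 0 for the moments. *)

Require Import Defs.
From HB Require Import structures.
From mathcomp Require Import all_boot all_order all_algebra.
From mathcomp Require Import all_classical all_reals all_analysis.
From mathcomp Require Import measurable_realfun ring lra.

Set Implicit Arguments.
Unset Strict Implicit.
Unset Printing Implicit Defensive.

Import Order.TTheory GRing.Theory Num.Theory.
Import numFieldNormedType.Exports.

Local Open Scope classical_set_scope.
Local Open Scope ring_scope.

(** * Expectations of products of functions of independent variables *)

Section product_expectation.
Local Open Scope ereal_scope.
Context (d d' : measure_display) (Omega : measurableType d)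
  (S : measurableType d') (R : realType).

Import HBNNSimple.

(** The last premise is the case of indicators, so linearity over the level sets of [h] suffices. It
    is the form in which independence of [G] and [X] enters. *)
Lemma integral_mul_nnsfun (P : {measure set Omega -> \bar R})
    (G : Omega -> R) (X : Omega -> S) (c : R) (h : {nnsfun S >-> R}) :
  measurable_fun setT G -> (forall w, 0 <= G w)%R ->
  measurable_fun setT X ->
  (forall A, measurable A ->
    \int[P]_w (G w * \1_A (X w))%:E = c%:E * P (X @^-1` A)) ->
  \int[P]_w (G w * h (X w))%:E = c%:E * \int[P]_w (h (X w))%:E.
Proof.
move=> mG G0 mX GX.
have mhX r : measurable (X @^-1` (h @^-1` [set r])).
  by rewrite -[X in measurable X]setTI; exact: mX.
have m1 (r : R) : measurable_fun setT (fun w => \1_(h @^-1` [set r]) (X w) : R).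
  by apply: measurableT_comp mX; exact: measurable_indic.
have m1G (r : R) : measurable_fun setT
    (fun w => G w * \1_(h @^-1` [set r]) (X w) : R)%R by exact: measurable_funM.
transitivity (\sum_(r \in range h)
   \int[P]_w (r%:E * (G w * \1_(h @^-1` [set r]) (X w))%:E)).
  rewrite -ge0_integral_fsum//; last 2 first.
  - by move=> r; apply/measurable_EFinP; exact: measurable_funM.
  - move=> r w _; rewrite -EFinM mulrCA EFinM mule_ge0 ?lee_fin//.
    exact: nnfun_muleindic_ge0.
  apply: eq_integral => w _.
  rewrite [in LHS]fimfunE /= mulr_fsumr// -fsumEFin//.
  by apply: eq_fsbigr => r _; rewrite -EFinM mulrCA.
transitivity (\sum_(r \in range h) c%:E * (r%:E * P (X @^-1` (h @^-1` [set r])))).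
  apply: eq_fsbigr => r /[!inE] -[s _ <-].
  rewrite ge0_integralZl_EFin//; last 2 first.
  - by move=> w _; rewrite lee_fin mulr_ge0.
  - by apply/measurable_EFinP.
  by rewrite GX// muleCA.
rewrite -ge0_mule_fsumr; last first.
  (* The sign is required at every real [r]; a negative [r] has an empty level set, hence a zero
     term. *)
  move=> r; have [r0|r0] := leP 0%R r; first by rewrite mule_ge0.
  by rewrite preimage_nnfun0// preimage_set0 measure0 mule0.
congr (_ * _); rewrite [RHS](_ : _ = \int[P]_w (\sum_(r \in range h)
    (r * \1_(h @^-1` [set r]) (X w))%:E)); last first.
  by apply: eq_integral => w _; rewrite [in LHS]fimfunE -fsumEFin.
rewrite ge0_integral_fsum//; last 2 first.
  - by move=> r; apply/measurable_EFinP; exact: measurable_funM.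
  - by move=> r w _; exact: nnfun_muleindic_ge0.
apply: eq_fsbigr => r /[!inE] -[s _ <-].
under [RHS]eq_integral do rewrite EFinM.
rewrite ge0_integralZl_EFin//; last exact/measurable_EFinP.
congr (_ * _); rewrite -[X in P X]setIT -integral_indic//.
Qed.

(** Monotone convergence on both sides, along simple functions increasing to [g]. *)
Lemma integral_mul_comp (P : {measure set Omega -> \bar R})
    (G : Omega -> R) (X : Omega -> S) (c : R) (g : S -> R) :
  measurable_fun setT G -> (forall w, 0 <= G w)%R ->
  measurable_fun setT X ->
  (forall A, measurable A ->
    \int[P]_w (G w * \1_A (X w))%:E = c%:E * P (X @^-1` A)) ->
  measurable_fun setT g -> (forall s, 0 <= g s)%R ->
  \int[P]_w (G w * g (X w))%:E = c%:E * \int[P]_w (g (X w))%:E.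
Proof.
move=> mG G0 mX GX mg g0.
have mEg : measurable_fun setT (EFin \o g) by exact/measurable_EFinP.
pose h := nnsfun_approx measurableT mEg.
have hg w : (h n (X w))%:E @[n --> \oo] --> (g (X w))%:E.
  by apply: cvg_nnsfun_approx => // s _; rewrite lee_fin.
have nd_h w : {homo (fun n => h n (X w)) : m n / (m <= n)%N >-> (m <= n)%R}.
  by move=> m n mn; exact/lefP/nd_nnsfun_approx.
have mh n : measurable_fun setT (fun w => h n (X w)).
  exact: measurableT_comp.
have : \int[P]_w (G w * h n (X w))%:E @[n --> \oo] -->
    \int[P]_w (G w * g (X w))%:E.
  have -> : \int[P]_w (G w * g (X w))%:E =
      \int[P]_w (limn (fun n => (G w * h n (X w))%:E)).
    apply: eq_integral => w _; apply/esym/cvg_lim => //.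
    by rewrite EFinM; under eq_fun do rewrite EFinM; exact: cvgeZl.
  apply: cvg_monotone_convergence => //.
  - by move=> n; apply/measurable_EFinP; exact: measurable_funM.
  - by move=> n w _; rewrite lee_fin mulr_ge0.
  - by move=> w _ m n mn; rewrite lee_fin ler_wpM2l// nd_h.
under eq_fun do rewrite (integral_mul_nnsfun _ mG G0 mX GX).
move=> /cvg_lim <-//; apply/cvg_lim => //; apply: cvgeZl => //.
have -> : \int[P]_w (g (X w))%:E = \int[P]_w (limn (fun n => (h n (X w))%:E)).
  by apply: eq_integral => w _; apply/esym/cvg_lim.
apply: cvg_monotone_convergence => //.
- by move=> n; exact/measurable_EFinP.
- by move=> n w _; rewrite lee_fin.
- by move=> w _ m n mn; rewrite lee_fin nd_h.
Qed.

End product_expectation.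

Section independent_product.
Local Open Scope ereal_scope.
Context (d d' : measure_display) (Omega : measurableType d)
  (S : measurableType d') (R : realType) (P : probability Omega R) (n : nat)
  (Z : 'I_n -> {RV P >-> S}).
Hypothesis Zindep : mutually_independent Z.

Lemma prod_indic_preimage (A : 'I_n -> set S) (w : Omega) :
  (\prod_(i < n) \1_(A i) (Z i w) = \1_(\bigcap_i (Z i @^-1` A i)) w :> R)%R.
Proof.
rewrite indicE; case: (boolP (w \in _)) => [/set_mem wA|/negP wA].
  by rewrite big1// => i _; rewrite indicE mem_set//; exact: wA.
have [i wAi] : exists i, ~ A i (Z i w).
  by apply/existsNP => wAi; apply: wA; rewrite inE => i _; exact: wAi.
by rewrite (bigD1 i)//= indicE memNset// mul0r.
Qed.

Lemma expectation_prod (g : 'I_n -> S -> R) :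
  (forall i, measurable_fun setT (g i)) -> (forall i s, 0 <= g i s)%R ->
  (forall i, \int[P]_w (g i (Z i w))%:E < +oo) ->
  \int[P]_w (\prod_(i < n) g i (Z i w))%:E =
  (\prod_(i < n) fine (\int[P]_w (g i (Z i w))%:E))%:E.
Proof.
move=> mg g0 goo.
have mZ i : measurable_fun setT (Z i) by exact: measurable_funP.
(* Interpolating family: [g] below index [k], indicators from [k] on. At [k = 0] independence
   applies directly, and [k = n] is the claim. *)
pose h k (A : 'I_n -> set S) (i : 'I_n) : S -> R :=
  if (i < k)%N then g i else \1_(A i).
have h0 k A i s : (0 <= h k A i s)%R by rewrite /h; case: ifP.
have mh k A i : (forall j, measurable (A j)) ->
    measurable_fun setT (fun w => h k A i (Z i w)).
  move=> mA; apply: measurableT_comp => //; rewrite /h; case: ifP => // _.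
have int1 B i : measurable B -> \int[P]_w (\1_B (Z i w))%:E = P (Z i @^-1` B).
  move=> mB; rewrite -[X in P X]setIT -integral_indic//.
  by rewrite -[X in measurable X]setTI; exact: mZ.
(* The sets stay quantified because the inductive step changes the one at index [k]. *)
suff hP k (A : 'I_n -> set S) : (forall i, measurable (A i)) ->
    \int[P]_w (\prod_(i < n) h k A i (Z i w))%:E =
    (\prod_(i < n) fine (\int[P]_w (h k A i (Z i w))%:E))%:E.
  have := hP n (fun=> setT) (fun=> measurableT).
  under eq_integral do under eq_bigr do rewrite /h ltn_ord.
  by under [X in _ = X%:E]eq_bigr do rewrite /h ltn_ord.
(* Indicators are replaced by the g i one index at a time. *)
elim: k A => [|k ih] A mA.
  under eq_integral do rewrite prod_indic_preimage.
  rewrite integral_indic ?setIT//; last first.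
    apply: fin_bigcap_measurable => // i _.
    by rewrite -[X in measurable X]setTI; exact: mZ.
  have := Zindep [set: 'I_n]%SET mA.
  rewrite (_ : [set` _] = setT); last first.
    by apply/seteqP; split => i //= _; rewrite inE.
  move=> PZ; rewrite -prodEFin; apply: (eq_trans PZ).
  apply: eq_big => [i|i _]; first by rewrite inE.
  by rewrite /h ltn0 int1// fineK// fin_num_measure// -[X in measurable X]setTI;
    exact: mZ.
have [kn|nk] := ltnP k n; last first.
  have hE i : h k.+1 A i = h k A i.
    have ik := leq_trans (ltn_ord i) nk.
    by rewrite /h ik ltnS (ltnW ik).
  under eq_integral do under eq_bigr do rewrite hE.
  by under [X in _ = X%:E]eq_bigr do rewrite hE; exact: ih.
pose i0 := Ordinal kn.
pose A' B (i : 'I_n) := if i == i0 then B else A i.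
have mA' B i : measurable B -> measurable (A' B i).
  by rewrite /A' => mB; case: ifP.
have hE B i : i != i0 -> h k.+1 A i = h k (A' B) i.
  move=> ii0; rewrite /h /A' (negbTE ii0) ltnS leq_eqVlt.
  by rewrite (_ : (i == k :> nat) = (i == i0))// (negbTE ii0).
have hi0 B : h k (A' B) i0 = \1_B by rewrite /h ltnn /A' eqxx.
have hi1 : h k.+1 A i0 = g i0 by rewrite /h ltnSn.
pose G w : R := (\prod_(i < n | i != i0) h k.+1 A i (Z i w))%R.
under eq_integral => w _.
  rewrite (bigD1 i0)//= hi1 mulrC -/(G w); over.
rewrite [RHS](_ : _ = ((\prod_(i < n | i != i0)
    fine (\int[P]_w (h k.+1 A i (Z i w))%:E)) *
    fine (\int[P]_w (g i0 (Z i0 w))%:E))%:E); last first.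
  by rewrite (bigD1 i0)//= hi1 mulrC.
rewrite EFinM fineK; last first.
  by rewrite ge0_fin_numE// integral_ge0// => w _; rewrite lee_fin.
apply: integral_mul_comp => //.
- rewrite (_ : G = fun w => \prod_(i < n)
      (if i != i0 then h k.+1 A i (Z i w) else 1))%R; last first.
    by apply/funext => w; exact: big_mkcond.
  by apply: measurable_prod => i _; case: (i != i0) => //; exact: mh.
- by move=> w; exact: prodr_ge0.
(* The indicator premise for [G] is the induction hypothesis for [A' B]: index [k] carries the
   indicator of [B], and the other factors are unchanged by [hE]. *)
move=> B mB; have := ih (A' B) (mA' B ^~ mB).
rewrite (bigD1 i0)//= hi0 int1// mulrC EFinM fineK; last first.
  by rewrite fin_num_measure// -[X in measurable X]setTI; exact: mZ.
rewrite [in X in _ = X -> _](eq_bigr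
  (fun i => fine (\int[P]_w (h k.+1 A i (Z i w))%:E))); last first.
  by move=> i ii0; rewrite (hE B).
move=> <-; apply: eq_integral => w _.
rewrite [in RHS](bigD1 i0)//= hi0 mulrC; congr (_ * _)%:E.
by apply: eq_bigr => i ii0; rewrite (hE B).
Qed.

End independent_product.

(** * Inequalities for powers and for the exponential series *)

(** The function [z ^ k * exp (- z)] decreases on [z >= k]; this follows from
    [ln (b / a) <= b / a - 1] and [k <= a]. It will give the sign of a derivative. *)
Lemma powR_le_mul_expR (R : realType) (k a b : R) :
  0 <= k -> k <= a -> 0 < a -> a <= b -> b `^ k <= a `^ k * expR (b - a).
Proof.
move=> k0 ka a0 ab; have b0 : 0 < b by exact: lt_le_trans ab.
rewrite /powR !gt_eqF// -expRD ler_expR addrC -lerBlDr -mulrBr.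
rewrite -ln_div ?posrE//.
have lnba : ln (b / a) <= (b - a) / a.
  have -> : b / a = 1 + (b - a) / a by field; rewrite gt_eqF.
  by apply: le_ln1Dx; rewrite (@lt_le_trans _ _ 0)// divr_ge0// ?subr_ge0// ltW.
apply: (le_trans (ler_wpM2l k0 lnba)).
rewrite mulrCA ler_piMr ?subr_ge0// ler_pdivrMr ?mul1r//.
Qed.

(* The tangent inequality of the map z -> ln^m z, concave on z >= e^(m-1), at
   z = e^x and base point e^y. *)
Lemma powR_le_tangent (R : realType) (m x y : R) : 1 <= m ->
  0 < x -> m - 1 <= x -> 0 < y -> m - 1 <= y ->
  x `^ m <= y `^ m + m * y `^ (m - 1) * (expR (x - y) - 1).
Proof.
move=> m1 x0 mx y0 my.
have m0 : 0 <= m by rewrite (le_trans _ m1).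
have m10 : 0 <= m - 1 by rewrite subr_ge0.
(* Up to a constant, [g] is the tangent bound minus the power. By [powR_le_mul_expR] with exponent
   [m - 1], its derivative between [x] and [y] is nonpositive if [x < y] and nonnegative if [y < x],
   so [g y <= g x]. *)
pose g (z : R) := m * y `^ (m - 1) * (expR (z - y) - 1) - z `^ m.
pose dg (z : R) := m * (y `^ (m - 1) * expR (z - y) - z `^ (m - 1)).
have gE (z : R) : 0 < z -> is_derive z 1 g (dg z).
  move=> z0.
  have d1 : is_derive z 1 (fun u : R => u - y) 1.
    by apply: is_derive_eq; rewrite subr0.
  have d2 : is_derive z 1 (expR \o (fun u : R => u - y)) (expR (z - y) * 1).
    exact: is_derive1_comp.
  have d3 := is_deriveB (is_deriveZ (m * y `^ (m - 1))
    (is_deriveB d2 (is_derive_cst (1 : R) z 1))) (is_derive1_powR m z0).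
  rewrite /dg mulrBr -[X in X - _]/(m * (y `^ (m - 1) * expR (z - y))).
  by apply: is_derive_eq d3 _; rewrite mulr1 subr0 /GRing.scale/= mulrA.
have cg (u v : R) : 0 < u -> {within `[u, v], continuous g}.
  move=> u0; apply: derivable_within_continuous => z.
  rewrite in_itv/= => /andP[uz _].
  by have [] := gE _ (lt_le_trans u0 uz).
have gy : g y = - y `^ m by rewrite /g subrr expR0 subrr mulr0 add0r.
suff : g y <= g x by rewrite gy /g; lra.
have [xy|yx|->//] := ltgtP x y.
- have [|//|c] := @MVT _ g dg x y xy; last 2 first.
  + exact: cg.
  + rewrite in_itv/= => /andP[xc cy] /eqP; rewrite subr_eq => /eqP ->.
    rewrite gerDr mulr_le0_ge0 ?subr_ge0 ?(ltW xy)// mulr_ge0_le0// subr_le0.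
    have := powR_le_mul_expR m10 (le_trans mx (ltW xc)) (lt_trans x0 xc) (ltW cy).
    by rewrite -[y - c]opprB expRN ler_pdivlMr ?expR_gt0.
  + by move=> z; rewrite in_itv/= => /andP[xz _]; apply: gE; exact: lt_trans xz.
- have [|//|c] := @MVT _ g dg y x yx; last 2 first.
  + exact: cg.
  + rewrite in_itv/= => /andP[yc cx] /eqP; rewrite subr_eq => /eqP ->.
    rewrite lerDr mulr_ge0 ?subr_ge0 ?(ltW yx)// mulr_ge0// subr_ge0.
    exact: powR_le_mul_expR (ltW yc).
  + by move=> z; rewrite in_itv/= => /andP[xz _]; apply: gE; exact: lt_trans xz.
Qed.

(** The exponential series without its first two terms, with absolute values inside. A nonnegative
    series in the extended reals can be exchanged with an integral without any summability
    argument. *)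
Lemma expR_le_nneseries (R : realType) (y : R) :
  ((expR y - 1 - y)%:E <=
   \sum_(0 <= k <oo) (`|y| ^+ k.+2 / k.+2`!%:R)%:E)%E.
Proof.
have t0 k : (0 <= (`|y| ^+ k.+2 / k.+2`!%:R)%:E :> \bar R)%E.
  by rewrite lee_fin divr_ge0.
have part n : ((\sum_(0 <= k < n) y ^+ k.+2 / k.+2`!%:R)%:E <=
    \sum_(0 <= k <oo) (`|y| ^+ k.+2 / k.+2`!%:R)%:E)%E.
  apply: (@le_trans _ _ (\sum_(0 <= k < n) (`|y| ^+ k.+2 / k.+2`!%:R)%:E)%E).
    rewrite sumEFin lee_fin; apply: ler_sum => k _.
    by rewrite ler_wpM2r// -normrX ler_norm.
  exact: nneseries_lim_ge.
have : (0 <= \sum_(0 <= k <oo) (`|y| ^+ k.+2 / k.+2`!%:R)%:E)%E.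
  exact: nneseries_ge0.
move: part; case: (\sum_(0 <= k <oo) _)%E => [r|_ _|//]; last by rewrite leey.
move=> part _; rewrite lee_fin -addrA -opprD lerBlDr.
apply: limr_le; first exact: is_cvg_series_exp_coeff.
near=> n; have -> : n = n.-2.+2.
  by rewrite -subn2 -addn2 subnK//; near: n; exact: nbhs_infty_ge.
rewrite /series/= /exp_coeff/= big_nat_recl// big_nat_recl//= expr0 expr1.
rewrite fact0 !divr1 [leLHS]addrA addrC lerD2r.
by have := part n.-2; rewrite lee_fin.
Unshelve. all: by end_near. Qed.

Lemma geometric_nneseries_le (R : realType) (c q : R) :
  0 <= c -> 0 <= q -> q < 1 ->
  (\sum_(0 <= k <oo) (c * q ^+ k)%:E <= (c / (1 - q))%:E)%E.
Proof.
move=> c0 q0 q1; apply: lime_le.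
  by apply: is_cvg_nneseries => k _ _; rewrite lee_fin mulr_ge0// exprn_ge0.
apply: nearW => n; rewrite sumEFin lee_fin.
have := geometric_seriesE c (negbT (lt_eqF q1)).
move=> /funeqP/(_ n); rewrite /series/= => ->.
rewrite /= ler_pM2r ?invr_gt0 ?subr_gt0// mulrBr mulr1 gerBl.
by rewrite mulr_ge0// exprn_ge0.
Qed.

(** * From Bernstein's moment condition to exponential moments, and from exponential moments to
    [L^m] norms *)

Section bernstein.
Context (d : measure_display) (Omega : measurableType d) (R : realType)
  (P : probability Omega R).

(** The series is integrated termwise and the factorials cancel: moment [k + 2] contributes at most
    [s ^+ 2 * v / 2 * (a * s) ^+ k], a geometric series. Moments are controlled only after summing
    over [i], so the two sums are exchanged first. *)
Lemma bernstein_sum (n : nat) (Y : 'I_n -> Omega -> R) (a v s : R) :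
  (forall i, measurable_fun setT (Y i)) ->
  0 <= a -> 0 <= v -> 0 <= s -> a * s < 1 ->
  (forall m, (2 <= m)%N -> (\sum_(i < n) \int[P]_w (`|Y i w| ^+ m)%:E <=
    (m`!%:R / 2 * a ^+ (m - 2) * v)%:E)%E) ->
  (\sum_(i < n) \int[P]_w (expR (s * Y i w) - 1 - s * Y i w)%:E <=
    (s ^+ 2 * v / 2 / (1 - a * s))%:E)%E.
Proof.
move=> mY a0 v0 s0 as1 mom.
have mYk i k : measurable_fun setT (fun w => `|Y i w| ^+ k).
  by apply: measurable_funX; exact: measurableT_comp.
pose c k : R := s ^+ k.+2 / k.+2`!%:R.
have c0 k : 0 <= c k by rewrite divr_ge0// exprn_ge0.
have exc i : (\int[P]_w (expR (s * Y i w) - 1 - s * Y i w)%:E <=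
    \sum_(0 <= k <oo) (c k)%:E * \int[P]_w (`|Y i w| ^+ k.+2)%:E)%E.
  apply: (@le_trans _ _ (\int[P]_w
      (\sum_(0 <= k <oo) (c k * `|Y i w| ^+ k.+2)%:E))%E).
    apply: ge0_le_integral => //.
    - by move=> w _; rewrite lee_fin -addrA -opprD subr_ge0 expR_ge1Dx.
    - apply/measurable_EFinP; apply: measurable_funB.
        apply: measurable_funB => //; apply: measurableT_comp => //.
        exact: measurable_funM.
      exact: measurable_funM.
    - apply: (ge0_emeasurable_sum (P := xpredT)) => //.
        by move=> k w _ _; rewrite lee_fin mulr_ge0// exprn_ge0.
      by move=> k _; apply/measurable_EFinP; exact: measurable_funM.
    - move=> w _; apply: (le_trans (expR_le_nneseries _)).
      apply: lee_nneseries => // k _.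
      by rewrite lee_fin normrM exprMn ger0_norm// /c mulrAC.
  rewrite integral_nneseries//; last 2 first.
  - by move=> k; apply/measurable_EFinP; exact: measurable_funM.
  - by move=> k w _; rewrite lee_fin mulr_ge0// exprn_ge0.
  apply: lee_nneseries => k.
    move=> _ _; apply: integral_ge0 => w _.
    by rewrite lee_fin mulr_ge0// exprn_ge0.
  move=> _.
  under eq_integral do rewrite EFinM.
  rewrite ge0_integralZl_EFin//; last exact/measurable_EFinP.
apply: (le_trans (lee_sum _ (fun i _ => exc i))).
rewrite -nneseries_sum; last first.
  move=> i k _; rewrite mule_ge0 ?lee_fin//.
  by apply: integral_ge0 => w _; rewrite lee_fin exprn_ge0.
have as0 : 0 <= a * s by rewrite mulr_ge0.
apply: le_trans (geometric_nneseries_le _ as0 as1); last first.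
  by rewrite !mulr_ge0// exprn_ge0.
apply: lee_nneseries => [k _ _|k _].
  apply: sume_ge0 => i _; rewrite mule_ge0 ?lee_fin//.
  by apply: integral_ge0 => w _; rewrite lee_fin exprn_ge0.
rewrite -ge0_sume_distrr; last first.
  by move=> i _; apply: integral_ge0 => w _; rewrite lee_fin exprn_ge0.
apply: (le_trans (lee_wpmul2l _ (mom k.+2 isT))); first by rewrite lee_fin.
rewrite -EFinM lee_fin /c !subSS subn0 exprMn.
rewrite le_eqVlt; apply/orP; left; apply/eqP.
rewrite !exprS; field.
by rewrite gt_eqF// ltr0n fact_gt0.
Qed.

(** The linear term integrates to zero. Finiteness makes the nonnegative remainder integrable, which
    permits splitting the integral. *)
Lemma integral_expR_centered (Y : Omega -> R) (s : R) :
  P.-integrable setT (EFin \o Y) -> (\int[P]_w (Y w)%:E = 0)%E ->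
  (\int[P]_w (expR (s * Y w) - 1 - s * Y w)%:E < +oo)%E ->
  (\int[P]_w (expR (s * Y w))%:E =
   1 + \int[P]_w (expR (s * Y w) - 1 - s * Y w)%:E)%E.
Proof.
move=> iY Y0 Foo.
have mY : measurable_fun setT Y.
  by move/integrableP : iY => [/measurable_EFinP].
pose F w := expR (s * Y w) - 1 - s * Y w.
have mF : measurable_fun setT F.
  apply: measurable_funB; last exact: measurable_funM.
  by apply: measurable_funB => //; apply: measurableT_comp => //;
    exact: measurable_funM.
have F0 w : 0 <= F w by rewrite /F -addrA -opprD subr_ge0 expR_ge1Dx.
have iF : P.-integrable setT (EFin \o F).
  apply/integrableP; split; first exact/measurable_EFinP.
  by under eq_integral do rewrite /= ger0_norm//.
have i1 : P.-integrable setT (EFin \o cst (1 : R)).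
  exact: finite_measure_integrable_cst.
have isY : P.-integrable setT (fun w => s%:E * (Y w)%:E)%E.
  exact: integrableZl.
transitivity (\int[P]_w (((EFin \o cst 1%R) \+ (fun w => s%:E * (Y w)%:E)) w +
    (F w)%:E))%E.
  by apply: eq_integral => w _; rewrite /= -EFinM -!EFinD /F; congr _%:E; ring.
rewrite integralD//; last exact: integrableD.
congr (_ + _)%E; rewrite integralD//= integralZl// Y0 mule0 adde0.
by rewrite integral_cst// mul1e; exact: probability_setT.
Qed.

End bernstein.

Lemma integral_probability_cst (d : measure_display) (Omega : measurableType d)
    (R : realType) (P : probability Omega R) (r : R) :
  (\int[P]_w r%:E = r%:E)%E.
Proof.
rewrite integral_cst// -[RHS]mule1; congr (_ * _)%E.
exact: probability_setT.
Qed.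

Section bernstein_mgf.
Context (d d' : measure_display) (Omega : measurableType d)
  (S : measurableType d') (R : realType) (P : probability Omega R) (n : nat)
  (Z : 'I_n -> {RV P >-> S}).
Hypothesis Zindep : mutually_independent Z.

(** Independence gives a product of factors [1 + b i], and [1 + x <= exp x] turns it into the
    exponential of the sum of the [b i]. The individual laws thus matter only through a sum. *)
Lemma bernstein_mgf (h : 'I_n -> S -> R) (a v s : R) :
  (forall i, measurable_fun setT (h i)) ->
  (forall i, P.-integrable setT (EFin \o (h i \o Z i))) ->
  (forall i, (\int[P]_w (h i (Z i w))%:E = 0)%E) ->
  0 <= a -> 0 <= v -> 0 <= s -> a * s < 1 ->
  (forall m, (2 <= m)%N -> (\sum_(i < n) \int[P]_w (`|h i (Z i w)| ^+ m)%:E <=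
    (m`!%:R / 2 * a ^+ (m - 2) * v)%:E)%E) ->
  (\int[P]_w (expR (s * \sum_(i < n) h i (Z i w)))%:E <=
   (expR (s ^+ 2 * v / 2 / (1 - a * s)))%:E)%E.
Proof.
move=> mh ih h0 a0 v0 s0 as1 mom.
have mhZ i : measurable_fun setT (h i \o Z i).
  by move/integrableP : (ih i) => [/measurable_EFinP].
have := bernstein_sum (P := P) (Y := fun i => h i \o Z i) mhZ a0 v0 s0 as1 mom.
set b := fun i =>
  (\int[P]_w (expR (s * h i (Z i w)) - 1 - s * h i (Z i w))%:E)%E.
rewrite [X in (X <= _)%E -> _](_ : _ = \sum_(i < n) b i)%E// => sb.
have b0 i : (0 <= b i)%E.
  apply: integral_ge0 => w _.
  by rewrite lee_fin -addrA -opprD subr_ge0 expR_ge1Dx.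
have boo i : (b i < +oo)%E.
  apply: le_lt_trans (ltry (s ^+ 2 * v / 2 / (1 - a * s))).
  apply: le_trans sb; rewrite (bigD1 i)//= leeDl// sume_ge0//.
have EY i : (\int[P]_w (expR (s * h i (Z i w)))%:E = 1 + b i)%E.
  exact: (integral_expR_centered (ih i) (h0 i) (boo i)).
under eq_integral do rewrite mulr_sumr expR_sum.
rewrite (expectation_prod Zindep (g := fun i z => expR (s * h i z))); last 3 first.
- by move=> i; apply: measurableT_comp => //; exact: measurable_funM.
- by move=> i z; exact: expR_ge0.
- by move=> i; rewrite EY lte_add_pinfty// ltry.
have bfin i : b i \is a fin_num by rewrite ge0_fin_numE.
rewrite lee_fin; apply: (@le_trans _ _ (\prod_(i < n) expR (fine (b i)))).
  apply: ler_prod => i _; rewrite EY fineD//= expR_ge1Dx andbT.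
  by rewrite addr_ge0// fine_ge0.
rewrite -expR_sum ler_expR -lee_fin -sumEFin.
by under eq_bigr do rewrite fineK//.
Qed.

End bernstein_mgf.

(* Integrating the tangent inequality at H0 replaces Jensen's inequality. *)
Lemma Lnorm_le_ln (d : measure_display) (Omega : measurableType d)
    (R : realType) (P : probability Omega R) (m L H0 : R) (Q H : Omega -> R) :
  1 <= m -> 0 < L -> measurable_fun setT Q -> measurable_fun setT H ->
  (forall w, 0 <= Q w) -> (forall w, expR (L * Q w) <= H w) ->
  (forall w, expR (m - 1) < H w) ->
  expR (m - 1) < H0 -> (\int[P]_w (H w)%:E <= H0%:E)%E ->
  ('N[P]_(m%:E)[EFin \o Q] <= (ln H0 / L)%:E)%E.
Proof.
move=> m1 L0 mQ mH Q0 QH mHw mH0 EH.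
have m0 : 0 < m by exact: lt_le_trans m1.
have H00 : 0 < H0 by exact: lt_trans (expR_gt0 _) mH0.
set y := ln H0.
have my : m - 1 < y by rewrite -ltr_expR lnK.
have y0 : 0 < y by rewrite (le_lt_trans _ my)// subr_ge0.
have Hw0 w : 0 < H w by exact: lt_trans (expR_gt0 _) (mHw w).
(* The derivative of [ln^m] at [H0], since [y = ln H0]. *)
pose c := m * y `^ (m - 1) / H0.
have c0 : 0 <= c by rewrite divr_ge0 ?mulr_ge0 ?powR_ge0 ?(ltW m0)// ltW.
(* With [c * H0] on the left both sides are nonnegative, so they can be integrated before the [m]-th
   moment of [Q] is known to be finite; the constant is cancelled afterwards. *)
have ptw w : (L * Q w) `^ m + c * H0 <= y `^ m + c * H w.
  pose x := ln (H w).
  have mx : m - 1 < x by rewrite -ltr_expR lnK// posrE.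
  have x0 : 0 < x by rewrite (le_lt_trans _ mx)// subr_ge0.
  have LQ0 : 0 <= L * Q w by rewrite mulr_ge0// ltW.
  have Qx : L * Q w <= x by rewrite -ler_expR lnK// posrE.
  have : (L * Q w) `^ m <= x `^ m.
    by rewrite ge0_ler_powR ?nnegrE// ltW.
  have := powR_le_tangent m1 x0 (ltW mx) y0 (ltW my).
  rewrite expRB !lnK ?posrE//.
  have -> : m * y `^ (m - 1) * (H w / H0 - 1) = c * H w - c * H0.
    by rewrite /c; field; rewrite gt_eqF.
  lra.
have EQ : (\int[P]_w ((L * Q w) `^ m)%:E <= (y `^ m)%:E)%E.
  have mLQ : measurable_fun setT (fun w => (L * Q w) `^ m).
    by apply: (measurableT_comp (measurable_powR m)); exact: measurable_funM.
  have : (\int[P]_w (((L * Q w) `^ m)%:E + (c * H0)%:E) <=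
      \int[P]_w ((y `^ m)%:E + c%:E * (H w)%:E))%E.
    apply: ge0_le_integral => //.
    - by move=> w _; rewrite -EFinD lee_fin addr_ge0 ?powR_ge0// mulr_ge0// ltW.
    - by apply: emeasurable_funD => //; apply/measurable_EFinP.
    - apply: emeasurable_funD => //; apply: emeasurable_funM => //.
      exact/measurable_EFinP.
    - by move=> w _; rewrite -EFinM -!EFinD lee_fin.
  rewrite ge0_integralD//; last 3 first.
  - by move=> w _; rewrite lee_fin powR_ge0.
  - exact/measurable_EFinP.
  - by move=> w _; rewrite lee_fin mulr_ge0// ltW.
  rewrite ge0_integralD//; last 3 first.
  - by move=> w _; rewrite lee_fin powR_ge0.
  - by move=> w _; rewrite -EFinM lee_fin mulr_ge0// ltW.
  - by apply: emeasurable_funM => //; exact/measurable_EFinP.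
  rewrite ge0_integralZl_EFin//; last 2 first.
  - by move=> w _; rewrite lee_fin ltW.
  - exact/measurable_EFinP.
  rewrite !integral_probability_cst => le1.
  rewrite -(leeD2rE (x := (c * H0)%:E))//; apply: (le_trans le1).
  apply: leeD2l; rewrite (EFinM c H0).
  by apply: lee_wpmul2l => //; rewrite lee_fin.
have mQm : measurable_fun setT (fun w => (Q w `^ m)%:E).
  by apply/measurable_EFinP; exact: (measurableT_comp (measurable_powR m)).
have Qm0 w : (0 <= (Q w `^ m)%:E)%E by rewrite lee_fin powR_ge0.
have LQm : (\int[P]_w ((L * Q w) `^ m)%:E =
    (L `^ m)%:E * \int[P]_w (Q w `^ m)%:E)%E.
  rewrite -ge0_integralZl_EFin ?powR_ge0//.
  by apply: eq_integral => w _; rewrite -EFinM -powRM// ltW.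
have yL0 : 0 <= y / L by rewrite divr_ge0// ltW.
have NQ : (\int[P]_w (Q w `^ m)%:E <= ((y / L) `^ m)%:E)%E.
  have Lm0 : 0 < L `^ m by rewrite powR_gt0.
  rewrite -(@lee_pmul2l _ (L `^ m)%:E)// -LQm -EFinM -powRM ?(ltW L0)//.
  by have -> : L * (y / L) = y by rewrite mulrC divfK ?gt_eqF.
rewrite unlock/=.
rewrite [X in (X `^ _ <= _)%E](_ : _ = \int[P]_w (Q w `^ m)%:E)%E; last first.
  by apply: eq_integral => w _; rewrite ger0_norm.
have -> : y / L = ((y / L) `^ m) `^ m^-1.
  by rewrite -powRrM divff ?gt_eqF// powRr1.
rewrite -poweR_EFin; apply: gt0_ler_poweR => //.
- by rewrite invr_ge0 ltW.
- by rewrite in_itv/= leey andbT integral_ge0.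
- by rewrite in_itv/= leey andbT lee_fin powR_ge0.
Qed.

(** * Bounds under random selection among [p] variables, and the choice of the exponent *)

Section selection.
Context (d : measure_display) (Omega : measurableType d) (R : realType)
  (P : probability Omega R) (p : nat) (W : 'I_p -> Omega -> R)
  (jhat : Omega -> 'I_p) (Q : Omega -> R) (A L B : R).
Hypothesis mW : forall j, measurable_fun setT (W j).
Hypothesis mQ : measurable_fun setT Q.
Hypothesis QW : forall w, Q w <= A + Num.max 0 (W (jhat w) w).
Hypothesis L0 : 0 < L.
Hypothesis mgfW : forall j, (\int[P]_w (expR (L * W j w))%:E <= (expR B)%:E)%E.

Let mexpW j : measurable_fun setT (fun w => expR (L * W j w)).
Proof. by apply: measurableT_comp => //; exact: measurable_funM. Qed.

Let msum_expW : measurable_fun setT (fun w => \sum_(j < p) expR (L * W j w)).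
Proof. exact: measurable_sum. Qed.

Let integral_sum_expW :
  (\int[P]_w (\sum_(j < p) expR (L * W j w))%:E <= (p%:R * expR B)%:E)%E.
Proof.
under eq_integral do rewrite -sumEFin.
rewrite ge0_integral_sum//; last by move=> j; exact/measurable_EFinP.
apply: (le_trans (lee_sum _ (fun j _ => mgfW j))).
by rewrite sumEFin sumr_const card_ord mulr_natl.
Qed.

(** The random index disappears here, at the price of a sum over all indices and hence of a factor
    [p]. *)
Let expR_le_sum w : expR (L * W (jhat w) w) <= \sum_(j < p) expR (L * W j w).
Proof.
by rewrite (bigD1 (jhat w))//= lerDl sumr_ge0// => j _; exact: expR_ge0.
Qed.

Lemma selection_tail (c : R) : 0 < c ->
  (P [set w | (A + c <= Q w)%R] <= (p%:R * expR (B - L * c))%:E)%E.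
Proof.
move=> c0; pose G w := \sum_(j < p) expR (L * W j w).
have mG : measurable_fun setT (EFin \o G) by exact/measurable_EFinP.
have G0 w : 0 <= G w by apply: sumr_ge0 => j _; exact: expR_ge0.
have mge (g : Omega -> R) (x : R) : measurable_fun setT g ->
    measurable [set w | x <= g w].
  move=> mg; rewrite -[X in measurable X]setTI.
  by apply: measurable_fun_le.
apply: (@le_trans _ _ (P [set w | (expR (L * c) <= G w)%R])).
  apply: le_measure; rewrite ?inE; [exact: mge..|].
  move=> w /= AcQ; apply: le_trans (expR_le_sum w).
  rewrite ler_expR ler_pM2l//.
  (* Positivity of [c] excludes the value [0] of the maximum. *)
  have := le_trans AcQ (QW w); rewrite lerD2l le_max => /orP[|//].
  by rewrite leNgt c0.
have := le_integral_abse P measurableT mG (expR_gt0 (L * c)).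
rewrite setTI.
have -> : [set x | ((expR (L * c))%:E <= `|(EFin \o G) x|)%E] =
    [set w | expR (L * c) <= G w].
  by apply/seteqP; split => w /=; rewrite lee_fin ger0_norm.
rewrite [X in (_ <= X)%E -> _](_ : _ = \int[P]_w (G w)%:E)%E; last first.
  by apply: eq_integral => w _; rewrite /= ger0_norm.
move=> /le_trans/(_ integral_sum_expW).
move=> le_pB; rewrite -(@lee_pmul2l _ (expR (L * c))%:E) ?lte_fin ?expR_gt0//.
rewrite -EFinM (_ : expR (L * c) * _ = p%:R * expR B)// expRB. field.
by rewrite gt_eqF// expR_gt0.
Qed.

Lemma selection_Lnorm (m sigma : R) : 0 <= A -> 0 <= B -> 0 < sigma ->
  (forall w, 0 <= Q w) -> (0 < p)%N -> 1 <= m -> m <= 1 + ln p%:R ->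
  ('N[P]_(m%:E)[(fun w => (Q w / sigma)%:E)] <=
   ((A + (ln (2 * p%:R) + B) / L) / sigma)%:E)%E.
Proof.
move=> A0 B0 s0 Q0 p0 m1 mp.
have pR0 : 0 < p%:R :> R by rewrite ltr0n.
have emp : expR (m - 1) <= p%:R.
  by rewrite -[leRHS]lnK ?posrE// ler_expR lerBlDl.
have eLA : 1 <= expR (L * A) by rewrite -expR0 ler_expR mulr_ge0// ltW.
pose G w := \sum_(j < p) expR (L * W j w).
have G0 w : 0 < G w by exact: lt_le_trans (expR_gt0 _) (expR_le_sum w).
(* Adding [expR (m - 1)] keeps [H] where [ln^m] is concave, and covers the case of a negative
   [W (jhat w) w]. Since [expR (m - 1) <= p <= p * expR B], the price is the factor 2 in [H0], which
   is the 2 inside the logarithm of [Delta]. *)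
pose H w := expR (L * A) * (expR (m - 1) + G w).
pose H0 := expR (L * A) * (2 * p%:R * expR B).
have eB1 : 1 <= expR B by rewrite -expR0 ler_expR.
have -> : (A + (ln (2 * p%:R) + B) / L) / sigma = ln H0 / (L * sigma).
  rewrite /H0 !lnM ?posrE ?mulr_gt0 ?expR_gt0// !expRK; field.
  by rewrite !gt_eqF.
apply: (@Lnorm_le_ln _ _ _ P m (L * sigma) H0 _ H) => //.
- exact: mulr_gt0.
- exact: measurable_funM.
- by apply: measurable_funM => //; exact: measurable_funD.
- by move=> w; rewrite divr_ge0// ltW.
- move=> w; have -> : L * sigma * (Q w / sigma) = L * Q w.
    by field; rewrite gt_eqF.
  have [W0|W0] := leP 0 (W (jhat w) w).
    apply: (@le_trans _ _ (expR (L * A) * expR (L * W (jhat w) w))).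
      rewrite -expRD ler_expR -mulrDr ler_pM2l//.
      by have := QW w; rewrite max_r.
    rewrite ler_pM2l ?expR_gt0//.
    by rewrite (le_trans (expR_le_sum w))// lerDr expR_ge0.
  apply: (@le_trans _ _ (expR (L * A) * 1)).
    rewrite mulr1 ler_expR ler_pM2l//.
    by have := QW w; rewrite max_l ?addr0// ltW.
  rewrite ler_pM2l ?expR_gt0// (@le_trans _ _ (expR (m - 1)))//.
    by rewrite -[leLHS]expR0 ler_expR subr_ge0.
  by rewrite lerDl ltW.
- move=> w; rewrite /H; apply: (@lt_le_trans _ _ (expR (m - 1) + G w)).
    by rewrite ltrDl.
  by rewrite ler_peMl// addr_ge0 ?expR_ge0// ltW.
- rewrite /H0; apply: (le_lt_trans emp).
  apply: (@lt_le_trans _ _ (2 * p%:R * 1)).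
    lra.
  apply: (@le_trans _ _ (2 * p%:R * expR B)).
    by rewrite ler_pM2l// mulr_gt0.
  by rewrite ler_peMl// mulr_ge0 ?expR_ge0// mulr_ge0.
rewrite /H /H0.
under eq_integral do rewrite EFinM EFinD.
rewrite ge0_integralZl_EFin ?expR_ge0//; last 2 first.
- by move=> w _; rewrite -EFinD lee_fin addr_ge0 ?expR_ge0// ltW.
- by apply: emeasurable_funD => //; exact/measurable_EFinP.
rewrite EFinM; apply: lee_wpmul2l; first by rewrite lee_fin expR_ge0.
rewrite ge0_integralD//; last 2 first.
- by move=> w _; rewrite lee_fin ltW.
- exact/measurable_EFinP.
rewrite integral_probability_cst.
rewrite -mulrA (_ : 2 * _ = p%:R * expR B + p%:R * expR B); last by ring.
rewrite EFinD; apply: leeD => //.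
by rewrite lee_fin (le_trans emp)// ler_peMr// ltW.
Qed.

End selection.

(* The exponent s is the Legendre optimum: it makes the bound on the log-moment
   generating function, divided by s, equal to the Bernstein radius. *)
Lemma bernstein_exponent_optimum (R : realType) (C k r : R) :
  0 < C -> 0 < k -> 0 < r ->
  let s := r / (C + 2 * k * r) in
  [/\ 0 < s, 2 * k * s < 1 &
      s ^+ 2 * C ^+ 2 / 2 / (1 - 2 * k * s) =
      s * (C * r + k * r ^+ 2) - r ^+ 2 / 2].
Proof.
move=> C0 k0 r0 s.
have kr0 : 0 < 2 * k * r by rewrite !mulr_gt0.
have D0 : 0 < C + 2 * k * r by exact: addr_gt0.
split; first exact: divr_gt0.
  by rewrite /s mulrA ltr_pdivrMr// mul1r ltrDr.
rewrite /s; field.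
have -> : C + 2 * k * r - 2 * k * r = C by ring.
by rewrite !gt_eqF.
Qed.

(** * Excess risk of the empirical risk minimizer *)

Lemma avg_mean_sub (R : realType) (d d' : measure_display)
    (Omega : measurableType d) (S : measurableType d') (P : probability Omega R)
    (n : nat) (Z : 'I_n -> {RV P >-> S}) (g h : S -> R) :
  (forall i, P.-integrable setT (EFin \o (g \o Z i))) ->
  (forall i, P.-integrable setT (EFin \o (h \o Z i))) ->
  avg_mean Z (g \- h) = avg_mean Z g - avg_mean Z h.
Proof.
move=> ig ih; rewrite /avg_mean -mulrBr -sumrB; congr (_ * _).
apply: eq_bigr => i _; rewrite /mean unlock.
rewrite -fineB; [|exact: (integrable_fin_num measurableT (ig i))
  |exact: (integrable_fin_num measurableT (ih i))].
by congr fine; rewrite -integralB_EFin.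
Qed.

Section excess_risk.
Context (R : realType) (d d' : measure_display) (Omega : measurableType d)
  (S : measurableType d') (P : probability Omega R) (n : nat)
  (Z : 'I_n -> {RV P >-> S}).
Hypotheses (n_gt0 : (0 < n)%N) (Zindep : mutually_independent Z).

Lemma measurable_fun_ord (p : nat) (jhat : Omega -> 'I_p) (phi : 'I_p -> R) :
  (forall j, measurable [set w | jhat w = j]) ->
  measurable_fun setT (phi \o jhat).
Proof.
move=> mj _ Y mY; rewrite setTI.
rewrite (_ : _ @^-1` Y = \bigcup_(j in [set j | Y (phi j)]) [set w | jhat w = j]).
  exact: fin_bigcup_measurable.
apply/seteqP; split => [w Yw|w [j Yj /= jw]]; first by exists (jhat w).
by rewrite jw.
Qed.

(** Bernstein's bound for the functions [u i], which depend on [i] through the centering.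
    Multiplying the averaged moment condition by [n] bounds the sum over [i], with variance constant
    [n * D]. *)
Lemma centered_difference_mgf (g h : S -> R) (a D s : R) :
  measurable_fun setT g -> measurable_fun setT h ->
  (forall i, P.-integrable setT (EFin \o (g \o Z i))) ->
  (forall i, P.-integrable setT (EFin \o (h \o Z i))) ->
  0 <= a -> 0 <= D -> 0 <= s -> a * s < 1 ->
  (forall m, (2 <= m)%N -> (avg_centered_moment Z m g h <=
    (m`!%:R / 2 * a ^+ (m - 2) * D)%:E)%E) ->
  (\int[P]_w (expR (s * \sum_(i < n) (centered Z h i w - centered Z g i w)))%:E
   <= (expR (n%:R * (s ^+ 2 * D / 2 / (1 - a * s))))%:E)%E.
Proof.
move=> mg mh ig ih a0 D0 s0 as1 mom.
have nR0 : 0 < n%:R :> R by rewrite ltr0n.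
pose u i z := (h z - mean Z i h) - (g z - mean Z i g).
have icst (r : R) : P.-integrable setT (EFin \o cst r).
  exact: finite_measure_integrable_cst.
have icent f i : P.-integrable setT (EFin \o (f \o Z i)) ->
    P.-integrable setT (EFin \o (fun w => f (Z i w) - mean Z i f)).
  by move=> fi; exact: (integrableB measurableT fi (icst _)).
have cent0 f i : P.-integrable setT (EFin \o (f \o Z i)) ->
    (\int[P]_w (f (Z i w) - mean Z i f)%:E = 0)%E.
  move=> fi; under eq_integral do rewrite EFinB.
  rewrite (integralB_EFin measurableT fi (icst _)) /= integral_probability_cst.
  rewrite /mean unlock.
  by rewrite fineK ?subee//; exact: (integrable_fin_num measurableT fi).
have -> : n%:R * (s ^+ 2 * D / 2 / (1 - a * s)) =
    s ^+ 2 * (n%:R * D) / 2 / (1 - a * s) by ring.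
apply: (bernstein_mgf Zindep (h := u)) => //.
- by move=> i; apply: measurable_funB; exact: measurable_funB.
- by move=> i; exact: (integrableB measurableT (icent _ _ (ih i)) (icent _ _ (ig i))).
- move=> i; rewrite /u; under eq_integral do rewrite EFinB.
  rewrite (integralB_EFin measurableT (icent _ _ (ih i)) (icent _ _ (ig i))).
  by rewrite !cent0// subee.
- by rewrite mulr_ge0.
move=> m m2; have := mom m m2; rewrite /avg_centered_moment.
rewrite -(@lee_pmul2l _ (n%:R)%:E)// muleA -EFinM divff ?gt_eqF// mul1e.
rewrite -EFinM mulrCA => /(le_trans _); apply.
rewrite le_eqVlt; apply/orP; left; apply/eqP; apply: eq_bigr => i _.
by apply: eq_integral => w _; rewrite distrC.
Qed.

Context (T : metricType R) (p : nat) (f : 'I_p -> T) (f0 : T)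
  (gamma : T -> S -> R) (js : 'I_p) (jhat : Omega -> 'I_p) (C K : R).
Hypotheses (f_meas : forall j, measurable_fun setT (gamma (f j)))
  (f0_int : forall i, P.-integrable setT (EFin \o (gamma f0 \o Z i)))
  (f_int : forall j i, P.-integrable setT (EFin \o (gamma (f j) \o Z i)))
  (jhat_meas : forall j, measurable [set w | jhat w = j])
  (jhat_min : forall w,
    is_argmin setT (fun j => empirical_mean Z w (gamma (f j))) (jhat w))
  (C_gt0 : 0 < C) (K_gt0 : 0 < K)
  (margin : forall j,
    mdist (f j) f0 ^+ 2 / C ^+ 2 <= avg_mean Z (gamma (f j) \- gamma f0))
  (moments : forall (j : 'I_p) (m : nat), (2 <= m)%N ->
    (avg_centered_moment Z m (gamma (f j)) (gamma (f js)) <=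
     (m`!%:R / 2 * (2 * K) ^+ (m - 2) * mdist (f j) (f js) ^+ 2)%:E)%E).

Let excess j := avg_mean Z (gamma (f j) \- gamma f0).

Let excess_ge0 j : 0 <= excess j.
Proof. by apply: le_trans (margin j); rewrite divr_ge0// sqr_ge0. Qed.

Let mdist_le j : mdist (f j) f0 <= C * Num.sqrt (excess j).
Proof.
rewrite -(@ler_pXn2r _ 2)// ?nnegrE ?mulr_ge0 ?mdist_ge0 ?sqrtr_ge0 ?(ltW C_gt0)//.
rewrite exprMn sqr_sqrtr// mulrC -ler_pdivrMr ?exprn_gt0//; exact: margin.
Qed.

(** The [X_j] of the overview, written as an average of independent centered terms. *)
Let deviation j w : R :=
  n%:R^-1 * \sum_(i < n)
    (centered Z (gamma (f js)) i w - centered Z (gamma (f j)) i w).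

Let basic_inequality w : excess (jhat w) - excess js <= deviation (jhat w) w.
Proof.
have -> : deviation (jhat w) w =
    empirical_mean Z w (gamma (f js)) - empirical_mean Z w (gamma (f (jhat w))) +
    (avg_mean Z (gamma (f (jhat w))) - avg_mean Z (gamma (f js))).
  rewrite /deviation /empirical_mean /avg_mean -!mulrBr -mulrDr -!sumrB.
  by rewrite -big_split/=; congr (_ * _); apply: eq_bigr => i _;
    rewrite /centered; ring.
rewrite /excess !avg_mean_sub//.
have [_ /(_ js I)] := jhat_min w; lra.
Qed.

Section radius.
Variables (A r : R).
Hypotheses (A_gt0 : 0 < A) (r_gt0 : 0 < r) (sqrtE : Num.sqrt (excess js) <= A).

(** The Bernstein radius at level [r] for variance constant [C ^+ 2] and scale [2 * K / A]. The tail
    bound uses [r ^+ 2 = Delta + 2 * t / n], the moment bound [r ^+ 2 = Delta]. *)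
Let c := C * r + K * r ^+ 2 / A.
Let s := r / (C + 2 * (K / A) * r).
Let W j w := deviation j w / (Num.sqrt (excess j) + A).
Let L := s * n%:R.
(** The bound on the log-moment generating function at the optimal [s]. In this form [B - L * c] is
    visibly [- n * r ^+ 2 / 2]. *)
Let B := n%:R * (s * c - r ^+ 2 / 2).

Let s_props : [/\ 0 < s, 2 * (K / A) * s < 1 &
  s ^+ 2 * C ^+ 2 / 2 / (1 - 2 * (K / A) * s) = s * c - r ^+ 2 / 2].
Proof.
have [s0 ks sE] := bernstein_exponent_optimum C_gt0 (divr_gt0 K_gt0 A_gt0) r_gt0.
split => //; rewrite sE; congr (s * _ - _).
by rewrite /c mulrAC.
Qed.

Let N_gt0 j : 0 < Num.sqrt (excess j) + A.
Proof. by rewrite ltr_wpDl// sqrtr_ge0. Qed.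

Let L_gt0 : 0 < L.
Proof. by have [s0 _ _] := s_props; rewrite mulr_gt0// ltr0n. Qed.

Let B_ge0 : 0 <= B.
Proof.
have [s0 ks sE] := s_props.
rewrite /B -sE mulr_ge0// divr_ge0 ?subr_ge0 ?(ltW ks)//.
by rewrite divr_ge0// mulr_ge0// sqr_ge0.
Qed.

Let measurable_W j : measurable_fun setT (W j).
Proof.
apply: measurable_funM => //; apply: measurable_funM => //.
apply: measurable_sum => i.
by apply: measurable_funB; apply: measurable_funB => //;
  apply: measurableT_comp => //; exact: measurable_funP.
Qed.

(** With [a] the square root of the selected excess risk, [excess js <= A ^+ 2] and the basic
    inequality bound [(a - A) * (a + A)] by the deviation; the case [a <= A] is absorbed by the [0]
    of the maximum. *)
Let sqrt_excess_le w :
  Num.sqrt (excess (jhat w)) <= A + Num.max 0 (W (jhat w) w).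
Proof.
have [aA|Aa] := leP (Num.sqrt (excess (jhat w))) A.
  by rewrite (le_trans aA)// lerDl le_max lexx.
rewrite -lerBlDl le_max; apply/orP; right.
rewrite /W ler_pdivlMr// -subr_sqr sqr_sqrtr//.
apply: le_trans (basic_inequality w); rewrite lerD2l lerN2.
by rewrite -[leLHS]sqr_sqrtr// ler_pXn2r ?nnegrE ?sqrtr_ge0// ltW.
Qed.

(** Passing through [f0], the margin condition at [j] and at [js] gives a distance of at most
    [C * N], so the normalised variance is at most [C ^+ 2]; and [A <= N] bounds the scale
    [2 * K / N]. Neither bound depends on [j]. *)
Let mgf_W j : (\int[P]_w (expR (L * W j w))%:E <= (expR B)%:E)%E.
Proof.
have [s0 ks sE] := s_props.
set N := Num.sqrt (excess j) + A.
have N0 : 0 < N by exact: N_gt0.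
have AN : A <= N by rewrite /N lerDr sqrtr_ge0.
have nR0 : 0 < n%:R :> R by rewrite ltr0n.
have dN : mdist (f j) (f js) <= C * N.
  apply: (le_trans (metric_triangle _ f0 _)).
  rewrite [mdist f0 _]metric_sym /N mulrDr lerD//.
  by rewrite (le_trans (mdist_le js))// ler_pM2l.
have ksN : 2 * K * (s / N) <= 2 * (K / A) * s.
  have -> : 2 * (K / A) * s = 2 * K * (s / A) by ring.
  by rewrite ler_pM2l ?mulr_gt0// ler_pM2l// lef_pV2// posrE.
(* The [n] in [L] cancels the average in [deviation], and the weight [N] moves into the exponent
   [s / N]. *)
under eq_integral => w _.
  have -> : L * W j w = s / N * \sum_(i < n)
      (centered Z (gamma (f js)) i w - centered Z (gamma (f j)) i w).
    by rewrite /L /W /deviation -/N; field; rewrite !gt_eqF.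
  over.
apply: (le_trans (centered_difference_mgf (a := 2 * K)
  (D := mdist (f j) (f js) ^+ 2) _ _ _ _ _ _ _ _ _)) => //.
- by rewrite mulr_ge0// ltW.
- exact: sqr_ge0.
- by rewrite divr_ge0// ltW.
- exact: le_lt_trans ks.
- by move=> m m2; exact: moments.
rewrite lee_fin ler_expR /B -sE ler_pM2l//.
apply: ler_pM.
- by rewrite divr_ge0// mulr_ge0 ?sqr_ge0.
- by rewrite invr_ge0 subr_ge0 ltW// (le_lt_trans ksN).
- rewrite ler_pM2r ?invr_gt0// expr_div_n -mulrA ler_pM2l ?exprn_gt0//.
  rewrite mulrC ler_pdivrMr ?exprn_gt0// -exprMn.
  by rewrite ler_pXn2r ?nnegrE ?mdist_ge0 ?mulr_ge0 ?(ltW C_gt0) ?(ltW N0).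
- by rewrite lef_pV2 ?posrE ?subr_gt0// ?lerD2l ?lerN2// (le_lt_trans ksN).
Qed.

Let measurable_sqrt_excess :
  measurable_fun setT (fun w => Num.sqrt (excess (jhat w))).
Proof. exact: (measurable_fun_ord (fun j => Num.sqrt (excess j)) jhat_meas). Qed.

Lemma excess_risk_tail :
  (P [set w | (A + c <= Num.sqrt (excess (jhat w)))%R] <=
   (p%:R * expR (- (n%:R * r ^+ 2 / 2)))%:E)%E.
Proof.
have c0 : 0 < c by rewrite addr_gt0 ?divr_gt0 ?mulr_gt0// exprn_gt0.
have -> : - (n%:R * r ^+ 2 / 2) = B - L * c by rewrite /B /L; ring.
exact: (selection_tail measurable_W measurable_sqrt_excess sqrt_excess_le).
Qed.

(** For this [r], [ln (2 * p)] equals the [n * r ^+ 2 / 2] subtracted in [B], so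
    [(ln (2 * p) + B) / L] is again the radius [c]. *)
Lemma excess_risk_Lnorm (m sigma : R) : 0 < sigma ->
  1 <= m -> m <= 1 + ln p%:R -> r ^+ 2 = 2 * ln (2 * p%:R) / n%:R ->
  ('N[P]_(m%:E)[(fun w => (Num.sqrt (excess (jhat w)) / sigma)%:E)] <=
   ((A + c) / sigma)%:E)%E.
Proof.
move=> sigma0 m1 mp rE.
have nR0 : 0 < n%:R :> R by rewrite ltr0n.
have [s0 _ _] := s_props.
have -> : A + c = A + (ln (2 * p%:R) + B) / L.
  have -> : ln (2 * p%:R) = n%:R * (r ^+ 2 / 2).
    by rewrite rE; field; rewrite gt_eqF.
  by rewrite /B /L; congr (_ + _); field; rewrite !gt_eqF.
apply: (selection_Lnorm measurable_W measurable_sqrt_excess sqrt_excess_le) => //.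
- exact: ltW.
- exact: leq_trans (ltn_ord js).
Qed.

End radius.

End excess_risk.

Theorem lemma4p1 (R : realType)
  (d d' : measure_display) (Omega : measurableType d) (S : measurableType d')
  (P : probability Omega R)
  (n : nat) (n_gt0 : (0 < n)%N)
  (Z : 'I_n -> {RV P >-> S}) (Zindep : mutually_independent Z)
  (* the class of loss functions, indexed by a subset of a metric space *)
  (T : metricType R) (F : set T) (gamma : T -> S -> R)
  (gamma_meas : forall g, F g -> measurable_fun setT (gamma g))
  (gamma_int : forall g, F g -> forall i,
     P.-integrable setT (EFin \o (gamma g \o Z i)))
  (p : nat) (f : 'I_p -> T) (f_in : forall j, F (f j))
  (f0 : T) (f0_min : is_argmin F (fun g => avg_mean Z (gamma g)) f0)
  (js : 'I_p)
  (js_min : is_argmin setT (fun j => avg_mean Z (gamma (f j))) js)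
  (* the (random) index of the empirical risk minimizer *)
  (jhat : Omega -> 'I_p)
  (jhat_meas : forall j, measurable [set w | jhat w = j])
  (jhat_min : forall w,
     is_argmin setT (fun j => empirical_mean Z w (gamma (f j))) (jhat w))
  (C K : R) (C_gt0 : 0 < C) (K_gt0 : 0 < K)
  (margin : forall j,
     avg_mean Z (gamma (f j) \- gamma f0) >= mdist (f j) f0 ^+ 2 / C ^+ 2)
  (moments : forall (j : 'I_p) (m : nat), (2 <= m)%N ->
     (avg_centered_moment Z m (gamma (f j)) (gamma (f js)) <=
      (m`!%:R / 2 * (2 * K) ^+ (m - 2) * mdist (f j) (f js) ^+ 2)%:E)%E) :
  let Ehat w := avg_mean Z (gamma (f (jhat w)) \- gamma f0) in
  let Estar := avg_mean Z (gamma (f js) \- gamma f0) in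
  let Delta : R := 2 * ln (2 * p%:R) / n%:R in
  (forall t : R, 0 < t ->
    (0 < Estar ->
      (P [set w | (Num.sqrt (Ehat w) >=
           Num.sqrt Estar + C * Num.sqrt (Delta + 2 * t / n%:R)
           + K * (Delta + 2 * t / n%:R) / Num.sqrt Estar)%R]
       <= (expR (- t))%:E)%E) /\
    (Estar <= K * (Delta + 2 * t / n%:R) ->
      (P [set w | (Num.sqrt (Ehat w) >=
           (C + 2 * Num.sqrt K) * Num.sqrt (Delta + 2 * t / n%:R))%R]
       <= (expR (- t))%:E)%E)) /\
  (forall m : R, 1 <= m -> m <= 1 + ln p%:R ->
    (0 < Estar ->
      ('N[P]_(m%:E)[(fun w => (Num.sqrt (Ehat w / Estar)%R)%:E)]
       <= (1 + C * Num.sqrt (Delta / Estar) + K * Delta / Estar)%:E)%E) /\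
    (Estar <= K * Delta ->
      ('N[P]_(m%:E)[(fun w => (Num.sqrt (Ehat w))%:E)]
       <= ((C + 2 * Num.sqrt K) * Num.sqrt Delta)%:E)%E)).
Proof.
move=> Ehat Estar Delta.
have nR0 : 0 < n%:R :> R by rewrite ltr0n.
have p0 : (0 < p)%N by exact: leq_trans (ltn_ord js).
have p1 : 1 <= p%:R :> R by rewrite ler1n.
have f0_in : F f0 by case: f0_min.
have Estar0 : 0 <= Estar.
  by apply: le_trans (margin js); rewrite divr_ge0// sqr_ge0.
have ln0 : 0 < ln (2 * p%:R) :> R by rewrite ln_gt0//; lra.
have Delta0 : 0 < Delta by rewrite divr_gt0// mulr_gt0.
have tail (A r : R) := excess_risk_tail n_gt0 Zindep (A := A) (r := r)
  (fun j => gamma_meas _ (f_in j)) (gamma_int _ f0_in)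
  (fun j => gamma_int _ (f_in j)) jhat_meas jhat_min C_gt0 K_gt0 margin moments.
have norm (A r : R) := excess_risk_Lnorm n_gt0 Zindep (A := A) (r := r)
  (fun j => gamma_meas _ (f_in j)) (gamma_int _ f0_in)
  (fun j => gamma_int _ (f_in j)) jhat_meas jhat_min C_gt0 K_gt0 margin moments.
(* For [A = sqrt (K * D)] the term [K * D / A] equals [A]; the two copies make the factor 2 in front
   of [sqrt K]. *)
have sqrtKD D : 0 < D -> Num.sqrt (K * D) + (C * Num.sqrt D +
    K * Num.sqrt D ^+ 2 / Num.sqrt (K * D)) =
    (C + 2 * Num.sqrt K) * Num.sqrt D.
  move=> D0; rewrite sqrtrM ?ltW//.
  rewrite -[X in X * Num.sqrt D ^+ 2](sqr_sqrtr (ltW K_gt0)); field.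
  by rewrite !gt_eqF// sqrtr_gt0.
split.
  move=> t t0; set D := Delta + 2 * t / n%:R.
  have D0 : 0 < D by rewrite addr_gt0// divr_gt0// mulr_gt0.
  have rD : 0 < Num.sqrt D by rewrite sqrtr_gt0.
  have tailD A : 0 < A -> Num.sqrt Estar <= A ->
      (P [set w | (A + (C * Num.sqrt D + K * D / A) <= Num.sqrt (Ehat w))%R] <=
       (expR (- t))%:E)%E.
    move=> A0 EA; have := tail A (Num.sqrt D) A0 rD EA.
    rewrite sqr_sqrtr ?(ltW D0)// => /le_trans; apply.
    (* The factor [p] meets [exp (- ln (2 * p))], which leaves half of [exp (- t)]. *)
    rewrite lee_fin (_ : n%:R * D / 2 = ln (2 * p%:R) + t); last first.
      by rewrite /D /Delta; field; rewrite gt_eqF.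
    rewrite opprD expRD [expR (- ln _)]expRN lnK ?posrE; last by lra.
    rewrite mulrA ler_piMl ?expR_ge0// ler_pdivrMr; lra.
  split=> [E0|EK].
    have sE0 : 0 < Num.sqrt Estar by rewrite sqrtr_gt0.
    by have := tailD _ sE0 (lexx _); rewrite addrA.
  (* This level stays positive even if [Estar = 0], and dominates [sqrt Estar] by [EK]. *)
  have KD0 : 0 < Num.sqrt (K * D) by rewrite sqrtr_gt0 mulr_gt0.
  have := tailD _ KD0 (ler_wsqrtr EK).
  by have := sqrtKD D D0; rewrite sqr_sqrtr ?(ltW D0)// => ->.
move=> m m1 mp.
have rD : 0 < Num.sqrt Delta by rewrite sqrtr_gt0.
have rE : Num.sqrt Delta ^+ 2 = 2 * ln (2 * p%:R) / n%:R.
  by rewrite sqr_sqrtr// ltW.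
split=> [E0|EK].
  have sE0 : 0 < Num.sqrt Estar by rewrite sqrtr_gt0.
  (* Both [A] and [sigma] are [sqrt Estar], so [A / sigma] is the leading 1; in the other case
     [sigma] is 1. *)
  have := norm _ _ sE0 rD (lexx _) m _ sE0 m1 mp rE.
  rewrite [X in (X <= _)%E -> _](_ : _ =
      'N[P]_(m%:E)[(fun w => (Num.sqrt (Ehat w / Estar))%:E)])%E; last first.
    apply: eq_Lnorm => w; rewrite [in RHS]sqrtrM ?sqrtrV//.
    by apply: le_trans (margin (jhat w)); rewrite divr_ge0// sqr_ge0.
  rewrite [X in (_ <= X%:E)%E -> _](_ : _ =
      1 + C * Num.sqrt (Delta / Estar) + K * Delta / Estar)//.
  rewrite [Num.sqrt (Delta / _)]sqrtrM ?(ltW Delta0)// sqrtrV// sqr_sqrtr ?(ltW Delta0)//.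
  rewrite -[X in _ = _ + _ / X](sqr_sqrtr (ltW E0)); field.
  by rewrite gt_eqF.
have KD0 : 0 < Num.sqrt (K * Delta) by rewrite sqrtr_gt0 mulr_gt0.
have := norm _ _ KD0 rD (ler_wsqrtr EK) m _ ltr01 m1 mp rE.
rewrite divr1 sqrtKD// [X in (X <= _)%E -> _](_ : _ =
    'N[P]_(m%:E)[(fun w => (Num.sqrt (Ehat w))%:E)])%E//.
by apply: eq_Lnorm => w; rewrite divr1.
Qed.
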